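(* Let $\rho>0$ and assume $\Gamma(0)<\Gamma(1)$ and $1+\rho\ln\mu(0)>0$. Then for every $\rho$-admissible scaling $n\mapsto L_n$, \[ \lim_{n\to\infty}\mathbb{P}\big[\mathbb{M}(n;L_n)\text{ contains no isolated nodes}\big]=\begin{cases}0 & \text{if } 1+\rho\ln\Gamma(0)<0,\\ 1 & \text{if } 1+\rho\ln\Gamma(0)>0.\end{cases} \]
   Context: Homogeneous binary multiplicative attribute graph (MAG) model. Fix $\mu(0),\mu(1)\in(0,1)$ with $\mu(0)+\mu(1)=1$, and a symmetric $2\times2$ matrix $(q(a,b))_{a,b\in\{0,1\}}$ with $q(0,1)=q(1,0)$ and $0<q(a,b)<1$ for all $a,b$. On a probability space, let $\{A, A_\ell(u):\ell,u\ge1\}$ be i.i.d. $\{0,1\}$-valued with $\mathbb{P}[A=1]=\mu(1)$, $\mathbb{P}[A=0]=\mu(0)$, and independently let $\{U(u,v): 1\le u<v\}$ be i.i.d. uniform on $(0,1)$, with $U(v,u)=U(u,v)$. For $L\ge1$ put $\mathbf{A}_L(u)=(A_1(u),\dots,A_L(u))$ and $Q_L(\mathbf a,\mathbf b)=\prod_{\ell=1}^L q(a_\ell,b_\ell)$ for $\mathbf a,\mathbf b\in\{0,1\}^L$. The random graph $\mathbb{M}(n;L)$ has vertex set $\{1,\dots,n\}$ and an undirected edge between distinct $u,v$ iff $U(u,v)\le Q_L(\mathbf A_L(u),\mathbf A_L(v))$. A node is isolated if it has no neighbor. Set $\Gamma(a)=\mathbb{E}[q(a,A)]=q(a,0)\mu(0)+q(a,1)\mu(1)$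 for $a\in\{0,1\}$. For $\rho>0$, a scaling $n\mapsto L_n$ of positive integers is $\rho$-admissible if $L_n\sim\rho\ln n$ as $n\to\infty$. *)

(* Defs.v *)
From HB Require Import structures.
From mathcomp Require Import all_boot all_order all_algebra.
From mathcomp Require Import all_classical all_reals all_analysis.
Set Implicit Arguments. Unset Strict Implicit. Unset Printing Implicit Defensive.
Import Order.TTheory GRing.Theory Num.Theory.
Import numFieldNormedType.Exports.
Local Open Scope classical_set_scope.
Local Open Scope ring_scope.

(* Attributes take values in bool: false = 0, true = 1.
   Nodes are 0..n-1, attribute layers are 0..L-1 (0-based indexing).
   A l u : the l-th attribute of node u;  U u v (u < v) : the edge uniform. *)

Section MAG.
Context {R : realType}.

(* Gamma(a) = E[q(a,A)] = q(a,0) mu(0) + q(a,1) mu(1) *)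
Definition Gamma (mu0 mu1 : R) (q : bool -> bool -> R) (a : bool) : R :=
  q a false * mu0 + q a true * mu1.

Definition QL {T : Type} (q : bool -> bool -> R) (A : nat -> nat -> T -> bool)
  (L u v : nat) (w : T) : R :=
  \prod_(l < L) q (A l u w) (A l v w).

(* edge between distinct u, v in M(n;L); U(v,u) = U(u,v) via min/max *)
Definition mag_edge {T : Type} (q : bool -> bool -> R)
  (A : nat -> nat -> T -> bool) (U : nat -> nat -> T -> R)
  (L u v : nat) (w : T) : Prop :=
  u <> v /\ U (minn u v) (maxn u v) w <= QL q A L u v w.

Definition no_isolated {T : Type} (q : bool -> bool -> R)
  (A : nat -> nat -> T -> bool) (U : nat -> nat -> T -> R) (n L : nat) : set T :=
  [set w | forall u : 'I_n, exists v : 'I_n, mag_edge q A U L u v w].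

Definition mag_indep {d} {T : measurableType d} (P : probability T R)
  (A : nat -> nat -> T -> bool) (U : nat -> nat -> T -> R) : Prop :=
  forall (JA JU : seq (nat * nat)) (C : nat * nat -> set bool)
         (B : nat * nat -> set R),
    uniq JA -> uniq JU -> all (fun p => (p.1 < p.2)%N) JU ->
    (forall p, measurable (B p)) ->
    fine (P ((\bigcap_(p in [set p | p \in JA]) (A p.1 p.2 @^-1` C p))
          `&` (\bigcap_(p in [set p | p \in JU]) (U p.1 p.2 @^-1` B p))))
    = (\prod_(p <- JA) fine (P (A p.1 p.2 @^-1` C p)))
      * (\prod_(p <- JU) fine (P (U p.1 p.2 @^-1` B p))).

End MAG.

(* Main.v *)
Require Import Defs.
From HB Require Import structures.
From mathcomp Require Import all_boot all_order all_algebra.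
From mathcomp Require Import all_classical all_reals all_analysis.
From mathcomp Require Import ring lra.
Set Implicit Arguments.
Unset Strict Implicit.
Unset Printing Implicit Defensive.
Import Order.TTheory GRing.Theory Num.Theory.
Import numFieldNormedType.Exports.
Local Open Scope classical_set_scope.
Local Open Scope ring_scope.

(* Given the attributes a of a node, its edges to the other nodes are
   independent, each present with probability prod_l Gamma(a_l), which is at
   least Gamma(0)^L. If n Gamma(0)^L grows like a power of n, a node is thus
   isolated with probability at most exp(-(n-1) Gamma(0)^L), and a union bound
   gives the one-law.
   For the zero-law no second moment of the number of isolated nodes is needed.
   Let Y be the number of all-zero nodes, of mean m = n mu(0)^L -> oo, and W the
   number of ordered pairs (u, v) with u all-zero and adjacent to v, of mean at
   most m n Gamma(0)^L = o(m). If no node is isolated then Y <= W, and this is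
   unlikely by Chebyshev's inequality for Y and Markov's inequality for W. *)

(** * Expectations as real numbers *)

Section Mean.
Context {d : measure_display} {T : measurableType d} {R : realType}.
Context (P : probability T R).

(** Integrability is bundled with a real value of the integral, so that linearity and monotonicity
    give relations between reals, free of extended arithmetic. *)
Definition has_mean (f : T -> R) (e : R) : Prop :=
  P.-integrable setT (EFin \o f) /\ (\int[P]_w (f w)%:E = e%:E)%E.

Lemma has_mean_indic (E : set T) : measurable E ->
  has_mean \1_E (fine (P E)).
Proof.
move=> mE; split; first exact: integrable_indic.
by rewrite integral_indic// setIT fineK// fin_num_measure.
Qed.

Lemma has_mean_cst (c : R) : has_mean (fun=> c) c.
Proof.
split; first exact: finite_measure_integrable_cst.
by rewrite integral_cst// [X in (_ * X)%E]probability_setT mule1.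
Qed.

Lemma has_meanD (f g : T -> R) (a b : R) :
  has_mean f a -> has_mean g b -> has_mean (fun w => f w + g w) (a + b).
Proof.
move=> [fi fa] [gi gb]; split; first exact: integrableD fi gi.
under eq_integral do rewrite EFinD.
by rewrite integralD// fa gb EFinD.
Qed.

Lemma has_meanZ (f : T -> R) (c a : R) :
  has_mean f a -> has_mean (fun w => c * f w) (c * a).
Proof.
move=> [fi fa]; split; first exact: (integrableZl measurableT c fi).
under eq_integral do rewrite EFinM.
by rewrite integralZl// fa EFinM.
Qed.

Lemma has_mean_sum (I : Type) (s : seq I) (Q : pred I) (f : I -> T -> R)
    (a : I -> R) :
  (forall i, Q i -> has_mean (f i) (a i)) ->
  has_mean (fun w => \sum_(i <- s | Q i) f i w) (\sum_(i <- s | Q i) a i).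
Proof.
move=> fa; elim: s => [|i s IHs].
  rewrite big_nil; under eq_fun do rewrite big_nil.
  exact: has_mean_cst.
rewrite big_cons; under eq_fun do rewrite big_cons.
by case: ifPn => // Qi; apply: has_meanD; [exact: fa|exact: IHs].
Qed.

Lemma le_has_mean (f g : T -> R) (a b : R) :
  has_mean f a -> has_mean g b -> (forall w, f w <= g w) -> a <= b.
Proof.
move=> [fi fa] [gi gb] fg; rewrite -lee_fin -fa -gb.
by apply: le_integral => // w _; rewrite lee_fin.
Qed.

Lemma has_mean_eq (f g : T -> R) (a b : R) :
  has_mean f a -> has_mean g b -> f =1 g -> a = b.
Proof.
move=> fa gb fg; apply/eqP; rewrite eq_le.
by rewrite (le_has_mean fa gb) ?(le_has_mean gb fa)// => w; rewrite fg.
Qed.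

(** At each [w] the indicators of the pieces sum to that of [E], because only the piece [i = X w]
    can contain [w]; then take means. *)
Lemma probability_partition (I : finType) (X : T -> I) (E : set T) :
  measurable E -> (forall i, measurable (X @^-1` [set i])) ->
  fine (P E) = \sum_i fine (P (E `&` X @^-1` [set i])).
Proof.
move=> mE mX; apply: (has_mean_eq (has_mean_indic mE)).
  by apply: has_mean_sum => i _; apply: has_mean_indic; exact: measurableI.
move=> w; rewrite (bigD1 (X w))//= big1 ?addr0; first last.
  move=> i /eqP iX; rewrite indicE memNset//.
  by case=> _ /= /esym.
rewrite !indicE; congr (_%:R); congr nat_of_bool.
by apply/idP/idP; rewrite !inE// => -[].
Qed.

End Mean.

(** * Growth of [n * x ^ L n] under an admissible scaling *)

Section Asymptotics.
Context {R : realType}.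

(** Square the bound [1 + x / 2 <= expR (x / 2)]. *)
Lemma expR_ge_sqr (x : R) : 0 <= x -> x ^+ 2 / 4 <= expR x.
Proof.
move=> x0; have -> : x = 2%:R * (x / 2) by lra.
rewrite expRM_natl; have h := expR_ge1Dx (x / 2).
apply: le_trans (_ : (x / 2) ^+ 2 <= _); first by nra.
by rewrite lerXn2r// ?nnegrE ?expR_ge0 //; lra.
Qed.

Lemma cvg_ln_nat : (fun n => ln (n%:R : R)) @ \oo --> +oo.
Proof.
apply/cvgryPge => M; near=> n.
rewrite -[leLHS]expRK ler_ln ?posrE ?expR_gt0//.
  near: n; exact: (cvgryPge (fun n : nat => n%:R : R)).1 cvgr_idn _.
rewrite ltr0n; near: n; exact: nbhs_infty_gt.
Unshelve. all: by end_near. Qed.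

Context (rho : R) (L : nat -> nat).
Hypothesis rho0 : 0 < rho.
Hypothesis admL : (fun n => (L n)%:R / (rho * ln (n%:R : R))) @ \oo --> (1 : R).

(** The logarithm of [n * x ^ L n] is [ln n + L n * ln x]; dividing it by [ln n] gives the exponent
    [e n], whose limit is read off from [L n ~ rho * ln n]. *)
Lemma nat_mul_exp_admissible (x : R) : 0 < x ->
  exists2 e : nat -> R, e @ \oo --> 1 + rho * ln x &
  \forall n \near \oo, n%:R * x ^+ L n = expR (e n * ln n%:R).
Proof.
move=> x0.
exists (fun n => 1 + rho * ln x * ((L n)%:R / (rho * ln (n%:R : R)))).
  apply: cvgD; first exact: cvg_cst.
  by rewrite -[X in _ --> X]mulr1; apply: cvgM => //; exact: cvg_cst.
near=> n.
have n0 : (0 < n)%N by near: n; exact: nbhs_infty_gt.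
have ln0 : 0 < ln (n%:R : R).
  by near: n; exact: (cvgryPgt _).1 cvg_ln_nat 0.
rewrite mulrDl mul1r expRD lnK ?posrE ?ltr0n//; congr (_ * _).
rewrite -[in LHS](lnK x0) -expRM_natl; congr expR.
by field; rewrite !gt_eqF.
Unshelve. all: by end_near. Qed.

Lemma nat_mul_exp_le (x : R) : 0 < x -> 1 + rho * ln x < 0 ->
  exists2 c : R, 0 < c &
  \forall n \near \oo, n%:R * x ^+ L n <= expR (- (c * ln n%:R)).
Proof.
move=> x0 x1; have [e ecvg eE] := nat_mul_exp_admissible x0.
(* Half the distance from the limit of [e] to 0, so that [e n < - c] eventually. *)
pose c := - (1 + rho * ln x) / 2; exists c; first by rewrite /c; lra.
near=> n.
have -> : n%:R * x ^+ L n = expR (e n * ln n%:R) by near: n.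
have ln0 : 0 < ln (n%:R : R).
  by near: n; exact: (cvgryPgt _).1 cvg_ln_nat 0.
have : e n < - c.
  by near: n; apply: cvgr_lt ecvg _ _; rewrite /c; lra.
by rewrite ler_expR => ?; nra.
Unshelve. all: by end_near. Qed.

Lemma nat_mul_exp_ge (x : R) : 0 < x -> 0 < 1 + rho * ln x ->
  exists2 c : R, 0 < c &
  \forall n \near \oo, expR (c * ln n%:R) <= n%:R * x ^+ L n.
Proof.
move=> x0 x1; have [e ecvg eE] := nat_mul_exp_admissible x0.
pose c := (1 + rho * ln x) / 2; exists c; first by rewrite /c; lra.
near=> n.
have -> : n%:R * x ^+ L n = expR (e n * ln n%:R) by near: n.
have ln0 : 0 < ln (n%:R : R).
  by near: n; exact: (cvgryPgt _).1 cvg_ln_nat 0.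
have : c < e n.
  by near: n; apply: cvgr_gt ecvg _ _; rewrite /c; lra.
by rewrite ler_expR => ?; nra.
Unshelve. all: by end_near. Qed.

Lemma cvg_expRN_ln (c : R) : 0 < c ->
  (fun n => expR (- (c * ln (n%:R : R)))) @ \oo --> (0 : R).
Proof.
move=> c0; apply/cvgrPdist_lt => eps eps0; near=> n.
rewrite sub0r normrN ger0_norm ?expR_ge0// -[ltRHS]lnK// ltr_expR.
have : - ln eps / c < ln (n%:R : R).
  by near: n; exact: (cvgryPgt _).1 cvg_ln_nat _.
by rewrite ltr_pdivrMr// => ?; lra.
Unshelve. all: by end_near. Qed.

Lemma cvg_nat_mul_exp0 (x : R) : 0 < x -> 1 + rho * ln x < 0 ->
  (fun n => n%:R * x ^+ L n) @ \oo --> (0 : R).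
Proof.
move=> x0 x1; have [c c0 cle] := nat_mul_exp_le x0 x1.
apply: squeeze_cvgr (cvg_cst 0) (cvg_expRN_ln c0).
near=> n; rewrite mulr_ge0// ?exprn_ge0 ?(ltW x0)//=. near: n; exact: cle.
Unshelve. all: by end_near. Qed.

Lemma cvg_nat_mul_expV0 (x : R) : 0 < x -> 0 < 1 + rho * ln x ->
  (fun n => (n%:R * x ^+ L n)^-1) @ \oo --> (0 : R).
Proof.
move=> x0 x1; have [c c0 cle] := nat_mul_exp_ge x0 x1.
apply: squeeze_cvgr (cvg_cst 0) (cvg_expRN_ln c0).
near=> n; rewrite invr_ge0 mulr_ge0// ?exprn_ge0 ?(ltW x0)//=.
rewrite expRN lef_pV2 ?posrE ?expR_gt0//; first by near: n; exact: cle.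
by rewrite mulr_gt0 ?exprn_gt0// ltr0n; near: n; exact: nbhs_infty_gt.
Unshelve. all: by end_near. Qed.

(* With [s = ln n], the exponent is at most [s - c^2 s^2 / 8], which is
   eventually below [- s]. *)
Lemma cvg_nat_mul_expRN (x : R) : 0 < x -> 0 < 1 + rho * ln x ->
  (fun n => n%:R * expR (- (n.-1%:R * x ^+ L n))) @ \oo --> (0 : R).
Proof.
move=> x0 x1; have [c c0 cle] := nat_mul_exp_ge x0 x1.
apply: squeeze_cvgr (cvg_cst 0) (cvg_expRN_ln (@ltr01 R)).
near=> n; rewrite mulr_ge0// ?expR_ge0//=.
have n1 : (1 < n)%N by near: n; exact: nbhs_infty_gt.
have ln0 : 0 < ln (n%:R : R).
  by near: n; exact: (cvgryPgt _).1 cvg_ln_nat 0.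
rewrite -[X in X * _](@lnK _ n%:R) ?posrE ?ltr0n 1?ltnW//.
rewrite -expRD ler_expR mul1r.
(* Beyond this threshold [c^2 s^2 / 8] exceeds [2 s], where [s = ln n]. *)
have : 16 / c ^+ 2 < ln (n%:R : R).
  by near: n; exact: (cvgryPgt _).1 cvg_ln_nat _.
rewrite ltr_pdivrMr ?exprn_gt0// => lnc.
have h : expR (c * ln n%:R) <= n%:R * x ^+ L n by near: n; exact: cle.
have h2 : (c * ln n%:R) ^+ 2 / 4 <= expR (c * ln (n%:R : R)).
  by apply: expR_ge_sqr; rewrite mulr_ge0 ?ltW.
(* For [n >= 2], replacing [n] by [n - 1] costs at most a factor 2. *)
have h3 : n%:R / 2 * x ^+ L n <= n.-1%:R * x ^+ L n.
  rewrite ler_wpM2r ?exprn_ge0 ?(ltW x0)// ler_pdivrMr// -natrM ler_nat.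
  by case: (n) n1 => [|[|k]]//= _; rewrite muln2 -addnn addSnnS leq_addl.
have h4 : 16 * ln n%:R < (c * ln (n%:R : R)) ^+ 2.
  by rewrite exprMn (expr2 (ln _)) mulrA ltr_pM2r// mulrC.
rewrite mulrAC in h3; move: h h2 h3 h4.
move: (ln _) (_ ^+ 2) (expR _) (n%:R * _) (n.-1%:R * _) => *; lra.
Unshelve. all: by end_near. Qed.

End Asymptotics.

(** * Laws and independence of the attributes and edge uniforms *)

Lemma ltn_min_max (u v : nat) : (minn u v < maxn u v)%N = (u != v).
Proof. by case: (ltngtP u v) => // ->; rewrite ltnn. Qed.

Section Model.
Context {R : realType} {d : measure_display} {T : measurableType d}.
Context (P : probability T R) (mu0 mu1 : R) (q : bool -> bool -> R).
Context (A : nat -> nat -> T -> bool) (U : nat -> nat -> T -> R).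
Hypothesis mu0_gt0 : 0 < mu0.
Hypothesis mu1_gt0 : 0 < mu1.
Hypothesis mu_sum1 : mu0 + mu1 = 1.
Hypothesis q01 : forall a b, 0 < q a b /\ q a b < 1.
Hypothesis measurable_A : forall l u, measurable [set w | A l u w].
Hypothesis prob_A1 : forall l u, P [set w | A l u w] = mu1%:E.
Hypothesis prob_A0 : forall l u, P [set w | ~~ A l u w] = mu0%:E.
Hypothesis measurable_U :
  forall u v, (u < v)%N -> measurable_fun setT (U u v).
Hypothesis prob_U : forall u v, (u < v)%N -> forall B : set R, measurable B ->
  P (U u v @^-1` B) = (@lebesgue_measure R) (B `&` `]0, 1[).
Hypothesis indep : mag_indep P A U.

Definition mu (b : bool) : R := if b then mu1 else mu0.

Lemma preimage_attr l u b :
  A l u @^-1` [set b] = if b then [set w | A l u w] else [set w | ~~ A l u w].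
Proof. by apply/seteqP; split=> w /=; case: b => /=; case: (A l u w). Qed.

Lemma prob_attr l u b : fine (P (A l u @^-1` [set b])) = mu b.
Proof. by rewrite preimage_attr; case: b; rewrite ?prob_A1 ?prob_A0. Qed.

Lemma measurable_attr l u b : measurable (A l u @^-1` [set b]).
Proof.
rewrite preimage_attr; case: b => //.
rewrite (_ : [set w | ~~ A l u w] = ~` [set w | A l u w]).
  exact: measurableC.
by apply/seteqP; split=> w /= /negP.
Qed.

Lemma prob_unif_le u v x : (u < v)%N -> 0 < x < 1 ->
  fine (P (U u v @^-1` `]-oo, x])) = x.
Proof.
move=> uv /andP[x0 x1]; rewrite prob_U//.
rewrite (_ : _ `&` _ = `]0, x]%classic).
  by rewrite lebesgue_measure_itv/= lte_fin x0 sube0.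
apply/seteqP; split=> y /=; rewrite !in_itv/=.
  by move=> [-> /andP[->]].
by move=> /andP[-> yx]; rewrite yx (le_lt_trans yx).
Qed.

Lemma prob_unif_gt u v x : (u < v)%N -> 0 < x < 1 ->
  fine (P (U u v @^-1` `]x, +oo[)) = 1 - x.
Proof.
move=> uv /andP[x0 x1]; rewrite prob_U//.
rewrite (_ : _ `&` _ = `]x, 1[%classic).
  by rewrite lebesgue_measure_itv/= lte_fin x1 -EFinD.
apply/seteqP; split=> y /=; rewrite !in_itv/= ?andbT.
  by move=> [-> /andP[_ ->]].
by move=> /andP[xy ->]; rewrite xy (lt_trans x0).
Qed.

(* Independence for families indexed by arbitrary finite types; the
   constraints attached to a given variable are read off its indices. *)
Lemma mag_indep_fin (I K : finType) (f : I -> nat * nat) (e : K -> nat * nat)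
    (D : {set I}) (E : {set K}) (C : I -> set bool) (B : K -> set R) :
  injective f -> injective e ->
  (forall k, k \in E -> ((e k).1 < (e k).2)%N) ->
  (forall k, measurable (B k)) ->
  fine (P [set w | (forall i, i \in D -> C i (A (f i).1 (f i).2 w)) /\
                   (forall k, k \in E -> B k (U (e k).1 (e k).2 w))]) =
  (\prod_(i in D) fine (P (A (f i).1 (f i).2 @^-1` C i))) *
  \prod_(k in E) fine (P (U (e k).1 (e k).2 @^-1` B k)).
Proof.
move=> finj einj elt mB.
(* Transports the constraints to pairs of naturals without inverting [f]: by injectivity the
   intersection at [f i] has the single member [C i], and it is the full set off the range of
   [f]. *)
pose C' p := \bigcap_(i in [set i | f i = p]) C i.
pose B' p := \bigcap_(k in [set k | e k = p]) B k.
have C'E i : C' (f i) = C i.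
  by apply/seteqP; split=> x => [|Cx j /= /finj ->//]; apply; exact: erefl.
have B'E k : B' (e k) = B k.
  by apply/seteqP; split=> x => [|Bx j /= /einj ->//]; apply; exact: erefl.
have := @indep (map f (enum D)) (map e (enum E)) C' B'.
rewrite !big_map !big_enum.
under eq_bigr do rewrite C'E.
under [in X in _ * X]eq_bigr do rewrite B'E.
move=> <-; first last.
- move=> p; apply: fin_bigcap_measurable => //; exact: finite_finset.
- by apply/allP => _ /mapP[k + ->]; rewrite mem_enum; exact: elt.
- by rewrite map_inj_uniq ?enum_uniq.
- by rewrite map_inj_uniq ?enum_uniq.
congr (fine (P _)); apply/seteqP; split=> w /=.
  move=> [wC wB]; split=> _ /mapP[i + ->]; rewrite mem_enum => ?.
  - by rewrite /= C'E; exact: wC.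
  - by rewrite /= B'E; exact: wB.
move=> [wC wB]; split=> i iD.
- have := wC (f i); rewrite /= C'E; apply.
  by apply/mapP; exists i; rewrite ?mem_enum.
- have := wB (e i); rewrite /= B'E; apply.
  by apply/mapP; exists i; rewrite ?mem_enum.
Qed.

(** * Attribute vectors and the edges at one node *)

Section Graph.
Context (n L : nat).
Implicit Types (u v : 'I_n) (a b : {ffun 'I_L -> bool}).

Definition attr_vec (u : nat) (w : T) : {ffun 'I_L -> bool} :=
  [ffun l : 'I_L => A l u w].

Definition mu_vec a : R := \prod_l mu (a l).

Definition q_vec a b : R := \prod_l q (a l) (b l).

Lemma QLE u v w : QL q A L u v w = q_vec (attr_vec u w) (attr_vec v w).
Proof. by apply: eq_bigr => l _; rewrite !ffunE. Qed.

(** The form of independence used for all later probabilities: they involve attribute vectors and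
    the edges at a single node [u]. Distinct [v] then use distinct uniforms, and the vectors split
    into their layers. *)
Lemma star_prob u (V E : {set 'I_n}) (c : 'I_n -> {ffun 'I_L -> bool})
    (B : 'I_n -> set R) :
  u \notin E -> (forall v, measurable (B v)) ->
  fine (P [set w | (forall v, v \in V -> attr_vec v w = c v) /\
                   (forall v, v \in E -> B v (U (minn u v) (maxn u v) w))]) =
  (\prod_(v in V) mu_vec (c v)) *
  \prod_(v in E) fine (P (U (minn u v) (maxn u v) @^-1` B v)).
Proof.
move=> uE mB.
pose f (p : 'I_n * 'I_L) : nat * nat := (nat_of_ord p.2, nat_of_ord p.1).
pose e v : nat * nat := (minn u v, maxn u v).
pose VL : {set 'I_n * 'I_L} := [set p | p.1 \in V]%SET.
have finj : injective f by move=> [? ?] [? ?] [/val_inj -> /val_inj ->].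
have einj : injective e.
  move=> v v' [mine maxe]; apply: val_inj => /=.
  (* The sum of minimum and maximum is [u + v], which determines [v]. *)
  by apply: (@addnI u); rewrite -!(addn_min_max u) mine maxe.
have := @mag_indep_fin _ _ f e VL E
  (fun p => [set c p.1 p.2]) B finj einj.
move=> /(_ _ mB); rewrite /=.
under eq_bigr do rewrite prob_attr.
have -> : \prod_(v in V) mu_vec (c v) =
    \prod_(p in VL) mu (c p.1 p.2).
  by rewrite /mu_vec pair_big_dep/=; apply: eq_bigl => p; rewrite inE andbT.
move=> <-.
  congr (fine (P _)); apply/seteqP; split=> w /= [wV wE]; split=> //.
    by move=> [v l] /=; rewrite inE/= => /wV <-; rewrite ffunE.
  move=> v vV; apply/ffunP => l; rewrite ffunE.
  by apply: (wV (v, l)); rewrite inE.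
move=> v vE; have : (u != v :> nat) by apply: contraNneq uE => /val_inj ->.
by rewrite /e/= ltn_min_max.
Qed.

Lemma q_vec_gt0 a b : 0 < q_vec a b.
Proof. by apply: prodr_gt0 => l _; case: (q01 (a l) (b l)). Qed.

Lemma q_vec_lt1 a b : (0 < L)%N -> q_vec a b < 1.
Proof.
move=> L0; rewrite /q_vec (bigD1 (Ordinal L0))//=.
apply: le_lt_trans (q01 (a (Ordinal L0)) (b (Ordinal L0))).2.
rewrite ler_piMr//; first by rewrite ltW// (q01 _ _).1.
apply: prodr_ile1 => l; have [h1 h2] := q01 (a l) (b l).
by rewrite !ltW.
Qed.

Lemma mu_vec_ge0 a : 0 <= mu_vec a.
Proof. by apply: prodr_ge0 => l _; rewrite /mu; case: (a l); rewrite ltW. Qed.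

Lemma mu_vec_sum1 : \sum_a mu_vec a = 1.
Proof.
rewrite /mu_vec -(bigA_distr_bigA (fun _ : 'I_L => mu)) big1// => _ _.
by rewrite big_bool /= addrC.
Qed.

(** The layers are independent: the sum over vectors of a product over layers is the product of the
    sums in each layer, and layer [l] contributes [Gamma (a l)]. *)
Lemma sum_mu_q_vec a :
  \sum_b mu_vec b * q_vec a b = \prod_l Gamma mu0 mu1 q (a l).
Proof.
rewrite (eq_bigr (fun b => \prod_l (mu (b l) * q (a l) (b l)))); first last.
  by move=> b _; rewrite big_split.
rewrite -(bigA_distr_bigA (fun l x => mu x * q (a l) x)).
apply: eq_bigr => l _; rewrite big_bool /Gamma /=; ring.
Qed.

Lemma measurable_attr_vec u a : measurable (attr_vec u @^-1` [set a]).
Proof.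
rewrite (_ : _ @^-1` _ = \bigcap_(l in [set: 'I_L]) (A l u @^-1` [set a l])).
  by apply: fin_bigcap_measurable => // l _; exact: measurable_attr.
apply/seteqP; split=> w /=.
  by move=> <- l _; rewrite /= ffunE.
by move=> h; apply/ffunP => l; rewrite ffunE; exact: h.
Qed.

Lemma measurable_edge u v : measurable [set w | mag_edge q A U L u v w].
Proof.
have [->|uv] := eqVneq u v.
  rewrite (_ : [set _ | _] = set0)//; apply/seteqP; split=> w //.
  by case=> /(_ erefl).
have uv' : (u != v :> nat) by [].
have mm : (minn u v < maxn u v)%N by rewrite ltn_min_max.
rewrite (_ : [set _ | _] =
    setT `&` [set w | U (minn u v) (maxn u v) w <= QL q A L u v w]).
  apply: measurable_fun_le => //; first exact: measurable_U.
  apply: measurable_prod => l _.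
  have mA u' : measurable_fun setT (A l u').
    by apply: (measurable_fun_bool true); rewrite setTI; exact: measurable_attr.
  (* A case split on the two attributes turns the factor into nested conditionals between constants,
     which are measurable. *)
  rewrite (_ : (fun w => _) = (fun w => if A l u w then
      (if A l v w then q true true else q true false)
      else (if A l v w then q false true else q false false))).
    by do ?apply: measurable_fun_ifT.
  by apply/funext => w; case: (A l u w); case: (A l v w).
by apply/seteqP; split=> w /= [] //; split=> //; apply/eqP.
Qed.

Lemma measurable_no_isolated : measurable (no_isolated q A U n L).
Proof.
rewrite (_ : no_isolated _ _ _ _ _ = \bigcap_(u in [set: 'I_n])
    \bigcup_(v in [set: 'I_n]) [set w | mag_edge q A U L u v w]).
  apply: fin_bigcap_measurable => // u _.
  by apply: fin_bigcup_measurable => // v _; exact: measurable_edge.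
apply/seteqP; split=> w /=.
  by move=> h u _; have [v ?] := h u; exists v.
by move=> h u; have [v _ ?] := h u I; exists v.
Qed.

Lemma edgeE u v w : mag_edge q A U L u v w <->
  u != v /\ U (minn u v) (maxn u v) w <=
    q_vec (attr_vec u w) (attr_vec v w).
Proof.
rewrite /mag_edge QLE; split=> -[uv ?]; split=> //.
  by apply/eqP => uv'; apply: uv; rewrite uv'.
by move=> /val_inj/eqP; exact/negP.
Qed.

(** * Zero-law: all-zero nodes and their edges *)

Definition all_zero : {ffun 'I_L -> bool} := [ffun=> false].

Definition zero_node (u : nat) : set T := attr_vec u @^-1` [set all_zero].

Lemma mu_vec0 : mu_vec all_zero = mu0 ^+ L.
Proof.
rewrite /mu_vec (eq_bigr (fun=> mu0)) ?prodr_const ?card_ord// => l _.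
by rewrite ffunE.
Qed.

Lemma prob_zero_node u : fine (P (zero_node u)) = mu0 ^+ L.
Proof.
have := @star_prob u [set u]%SET finset.set0 (fun=> all_zero) (fun=> setT).
rewrite finset.in_set0 big_set1 big_set0 mulr1 mu_vec0 => <-//.
congr (fine (P _)); apply/seteqP; split=> w /=.
  by move=> zu; split=> [v /set1P ->|v]; rewrite ?finset.in_set0.
by move=> [zu _]; apply: zu; exact/set1P.
Qed.

Lemma prob_zero_nodeI u v : u != v ->
  fine (P (zero_node u `&` zero_node v)) = mu0 ^+ L * mu0 ^+ L.
Proof.
move=> uv.
have := @star_prob u [set u; v]%SET finset.set0 (fun=> all_zero) (fun=> setT).
rewrite finset.in_set0 big_setU1 ?finset.in_set1// big_set1 big_set0 mulr1.
rewrite mu_vec0 => <-//.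
congr (fine (P _)); apply/seteqP; split=> w /=.
  move=> [zu zv]; split=> [x|x]; rewrite ?finset.in_set0//.
  by move=> /set2P[] ->.
by move=> [zu _]; split; apply: zu; rewrite finset.in_set2 eqxx ?orbT.
Qed.

(** Condition on the vector [b] of [v]: the edge then has probability [q_vec all_zero b], whose
    average over [b] is [Gamma(0)^L]. *)
Lemma prob_zero_node_edge u v : (0 < L)%N -> u != v ->
  fine (P (zero_node u `&` [set w | mag_edge q A U L u v w])) =
  mu0 ^+ L * Gamma mu0 mu1 q false ^+ L.
Proof.
move=> L0 uv.
have mZ : measurable (zero_node u) by exact: measurable_attr_vec.
rewrite (probability_partition P (X := attr_vec v)); first last.
- exact: measurable_attr_vec.
- by apply: measurableI => //; exact: measurable_edge.
have -> : Gamma mu0 mu1 q false ^+ L = \sum_b mu_vec b * q_vec all_zero b.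
  rewrite sum_mu_q_vec (eq_bigr (fun=> Gamma mu0 mu1 q false)).
    by rewrite prodr_const card_ord.
  by move=> l _; rewrite ffunE.
rewrite mulr_sumr; apply: eq_bigr => b _.
(* Only the values at [u] and [v] are constrained below. *)
pose c (x : 'I_n) := if x == u then all_zero else b.
have cu : c u = all_zero by rewrite /c eqxx.
have cv : c v = b by rewrite /c eq_sym (negbTE uv).
have := @star_prob u [set u; v]%SET [set v]%SET c
  (fun=> `]-oo, (q_vec all_zero b)]%classic).
rewrite finset.in_set1 => /(_ uv); rewrite big_setU1 ?finset.in_set1//.
rewrite !big_set1 cu cv mu_vec0 prob_unif_le; first last.
- by rewrite q_vec_gt0 q_vec_lt1.
- by rewrite ltn_min_max.
rewrite mulrA => <-//.
congr (fine (P _)); apply/seteqP; split=> w /=.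
  move=> [[zu /edgeE[_ uve]] bv]; split=> x.
    by move=> /set2P[] ->; rewrite ?cu ?cv.
  by move=> /set1P ->; rewrite /= in_itv/= -{1}zu -bv.
move=> [wV wE].
have zu : attr_vec u w = all_zero by rewrite wV ?cu// finset.in_set2 eqxx.
have bv : attr_vec v w = b by rewrite wV ?cv// finset.in_set2 eqxx orbT.
split=> //; split=> //; apply/edgeE; split=> //; rewrite zu bv.
by have := wE v; rewrite finset.in_set1 eqxx /= in_itv/= => /(_ isT).
Qed.

(** [p] is the probability that a node is all-zero, and [m] the expected number of such nodes. *)
Let p : R := mu0 ^+ L.
Let m : R := n%:R * p.

Let p_gt0 : 0 < p. Proof. exact: exprn_gt0. Qed.

(** Expand the square into a double sum of covariances: those of distinct nodes vanish by
    independence, and each of the [n] diagonal ones is [p * (1 - p)]. *)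
Lemma has_mean_zero_count_var :
  has_mean P (fun w => (\sum_(u < n) (\1_(zero_node u) w - p)) ^+ 2) (m * (1 - p)).
Proof.
have mZ u : measurable (zero_node u) by exact: measurable_attr_vec.
have -> : m * (1 - p) =
    \sum_(u : 'I_n) \sum_(v : 'I_n) (if u == v then p * (1 - p) else 0).
  rewrite (eq_bigr (fun=> p * (1 - p))).
    by rewrite sumr_const card_ord /m -[RHS]mulr_natl mulrA.
  by move=> u _; rewrite -big_mkcond/= (big_pred1 u)// => v; rewrite /= eq_sym.
under eq_fun do rewrite expr2 big_distrlr/=.
apply: has_mean_sum => u _; apply: has_mean_sum => v _.
have -> : (fun w => (\1_(zero_node u) w - p) * (\1_(zero_node v) w - p)) =
    (fun w => (\1_(zero_node u `&` zero_node v) w + - p * \1_(zero_node u) w) +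
      (- p * \1_(zero_node v) w + p * p)).
  by apply/funext => w; rewrite indicI/=; ring.
have := has_meanD (has_meanD (has_mean_indic P (measurableI _ _ (mZ u) (mZ v)))
    (has_meanZ (- p) (has_mean_indic P (mZ u))))
  (has_meanD (has_meanZ (- p) (has_mean_indic P (mZ v))) (has_mean_cst P (p * p))).
rewrite !prob_zero_node; congr (has_mean _ _ _).
case: ifPn => [/eqP ->|uv].
  by rewrite setIid prob_zero_node -/p; ring.
by rewrite prob_zero_nodeI// -/p; ring.
Qed.

(* When [no_isolated] holds, [Y <= W] forces [Y <= m / 2] or [m / 2 <= W], and
   correspondingly the first or the second summand is at least 1. *)
Lemma no_isolated_indic_le w : (0 < n)%N ->
  \1_(no_isolated q A U n L) w <=
  4 / m ^+ 2 * (\sum_(u < n) (\1_(zero_node u) w - p)) ^+ 2 +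
  2 / m * \sum_(u < n) \sum_(v < n | u != v)
    \1_(zero_node u `&` [set w | mag_edge q A U L u v w]) w.
Proof.
move=> n0; have m0 : 0 < m by rewrite mulr_gt0 ?ltr0n.
set S := \sum_(u < n) (_ - p); set W := (X in _ + _ * X).
have W0 : 0 <= 2 / m * W.
  apply: mulr_ge0; first by rewrite divr_ge0// ltW.
  by do 2 (apply: sumr_ge0 => ? _).
have S0 : 0 <= 4 / m ^+ 2 * S ^+ 2.
  by apply: mulr_ge0 (sqr_ge0 _); rewrite divr_ge0// exprn_ge0// ltW.
have [NI|NI] := pselect (no_isolated q A U n L w); last first.
  rewrite indicE memNset//.
  exact: addr_ge0.
rewrite indicE mem_set//.
(* [S + m] is the number of all-zero nodes, and each of them has a neighbour, hence is the first
   entry of a pair counted by [W]. *)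
have SW : S + m <= W.
  rewrite /S sumrB sumr_const card_ord -[p *+ n]mulr_natl subrK.
  apply: ler_sum => u _; have [v uv] := NI u.
  have [uv' _] := (edgeE u v w).1 uv.
  rewrite (bigD1 v)//= ler_wpDr ?sumr_ge0// indicI/=.
  by rewrite [X in _ <= _ * X]indicE mem_set// mulr1.
have [Sm|Sm] := lerP S (- (m / 2)).
  rewrite ler_wpDr//.
  rewrite mulrAC ler_pdivlMr ?exprn_gt0// mul1r; nra.
rewrite ler_wpDl//.
by rewrite mulrAC ler_pdivlMr// mul1r; lra.
Qed.

(** Means of the pointwise bound: the variance term gives [4 (1 - p) / m <= 4 / m], and the at most
    [n^2] pairs give [(2 / m) n^2 p Gamma(0)^L = 2 n Gamma(0)^L]. *)
Lemma no_isolated_upper : (0 < n)%N -> (0 < L)%N ->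
  fine (P (no_isolated q A U n L)) <=
  4 * (n%:R * mu0 ^+ L)^-1 + 2 * (n%:R * Gamma mu0 mu1 q false ^+ L).
Proof.
move=> n0 L0; have m0 : 0 < m by rewrite mulr_gt0 ?ltr0n.
set G := Gamma _ _ _ _.
have G0 : 0 < G.
  by have [h1 _] := q01 false false; have [h2 _] := q01 false true;
     rewrite addr_gt0 ?mulr_gt0.
have mE u v : measurable (zero_node u `&` [set w | mag_edge q A U L u v w]).
  by apply: measurableI; [exact: measurable_attr_vec|exact: measurable_edge].
have W_mean := @has_mean_sum _ _ _ P _ (index_enum 'I_n) xpredT _ _
  (fun u _ => @has_mean_sum _ _ _ P _ (index_enum 'I_n) (fun v => u != v) _ _
  (fun v _ => has_mean_indic P (mE u v))).
have := le_has_mean (has_mean_indic P measurable_no_isolated)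
  (has_meanD (has_meanZ (4 / m ^+ 2) has_mean_zero_count_var)
             (has_meanZ (2 / m) W_mean)) (fun w => no_isolated_indic_le w n0).
move=> /le_trans; apply; apply: lerD.
  rewrite -/p -/m (_ : 4 / m ^+ 2 * _ = 4 / m * (1 - p)).
    by rewrite ler_piMr ?divr_ge0 ?(ltW m0)// lerBlDr lerDl ltW.
  by move: (m) m0 => x x0; field; rewrite gt_eqF.
rewrite mulrAC ler_pdivrMr// -mulrA ler_pM2l//.
(* The diagonal is added to make all [n^2] terms equal. *)
apply: (@le_trans _ _ (\sum_(u < n) \sum_(v < n) (p * G ^+ L))).
  apply: ler_sum => u _; rewrite [leLHS]big_mkcond/=; apply: ler_sum => v _.
  case: ifPn => [uv|_]; first by rewrite prob_zero_node_edge.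
  by rewrite mulr_ge0 ?exprn_ge0 ?ltW.
rewrite !sumr_const card_ord -[leLHS]mulr_natl -[X in _ * X <= _]mulr_natl /m.
rewrite le_eqVlt; apply/orP; left.
by apply/eqP; ring.
Qed.

(** * One-law: the probability that a node is isolated *)

Definition isolated u : set T :=
  [set w | forall v, ~ mag_edge q A U L u v w].

Lemma measurable_isolated u : measurable (isolated u).
Proof.
rewrite (_ : isolated u = \bigcap_(v in [set: 'I_n])
    ~` [set w | mag_edge q A U L u v w]).
  apply: fin_bigcap_measurable => // v _.
  by apply: measurableC; exact: measurable_edge.
by apply/seteqP; split=> w /= h v; [move=> _; exact: h|exact: (h v I)].
Qed.

(** Partition by the attributes [c] of all nodes. With these fixed, the [n - 1] non-edges at [u] are
    independent; summing over the vectors of the other nodes turns each [1 - q_vec] into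
    [1 - prod_l Gamma(a_l)], where [a] is the vector of [u]. *)
Lemma prob_isolated u : (0 < L)%N ->
  fine (P (isolated u)) =
  \sum_a mu_vec a * (1 - \prod_l Gamma mu0 mu1 q (a l)) ^+ n.-1.
Proof.
move=> L0.
pose X w : {ffun 'I_n -> {ffun 'I_L -> bool}} := [ffun v : 'I_n => attr_vec v w].
have XE (c : {ffun 'I_n -> {ffun 'I_L -> bool}}) :
    X @^-1` [set c] = \bigcap_(v in [set: 'I_n]) (attr_vec v @^-1` [set c v]).
  apply/seteqP; split=> w /=; first by move=> <- v _; rewrite /= ffunE.
  by move=> h; apply/ffunP => v; rewrite ffunE; exact: h.
rewrite (probability_partition P (X := X)); first last.
- move=> c; rewrite XE.
  by apply: fin_bigcap_measurable => // v _; exact: measurable_attr_vec.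
- exact: measurable_isolated.
(* Weight of the vector [b] at node [v] when [u] has vector [a]. At [v = u] it vanishes unless
   [b = a]; this makes the summand a product over all nodes, so that the sum over [c] factorizes for
   each [a]. *)
pose F a (v : 'I_n) b :=
  if v == u then (if b == a then mu_vec a else 0)
  else mu_vec b * (1 - q_vec a b).
transitivity (\sum_(c : {ffun 'I_n -> {ffun 'I_L -> bool}})
    \sum_a \prod_v F a v (c v)).
  (* Only [a = c u] gives a nonzero product. *)
  apply: eq_bigr => c _; rewrite (bigD1 (c u))//= [X in _ + X]big1 ?addr0; last first.
    by move=> a ac; rewrite (bigD1 u)//= /F eqxx eq_sym (negbTE ac) mul0r.
  pose B v : set R := `](q_vec (c u) (c v)), +oo[%classic.
  have -> : \prod_v F (c u) v (c v) =
      (\prod_(v in [set: 'I_n]%SET) mu_vec (c v)) *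
      \prod_(v in [set~ u]%SET) fine (P (U (minn u v) (maxn u v) @^-1` B v)).
    have -> : \prod_(v in [set: 'I_n]%SET) mu_vec (c v) =
        mu_vec (c u) * \prod_(v | v != u) mu_vec (c v).
      rewrite (bigD1 u) ?finset.in_setT//=; congr (_ * _).
      by apply: eq_bigl => v; rewrite finset.in_setT.
    have -> : \prod_(v in [set~ u]%SET)
          fine (P (U (minn u v) (maxn u v) @^-1` B v)) =
        \prod_(v | v != u) (1 - q_vec (c u) (c v)).
      apply: eq_big => v; rewrite finset.in_setC1// => vu.
      by rewrite prob_unif_gt ?q_vec_gt0 ?q_vec_lt1// ltn_min_max eq_sym.
    rewrite -mulrA -big_split/= (bigD1 u)//= {1}/F !eqxx; congr (_ * _).
    by apply: eq_bigr => v vu; rewrite /F (negbTE vu).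
  rewrite -star_prob ?finset.in_setC1 ?eqxx//; last first.
    by move=> v; exact: measurable_itv.
  congr (fine (P _)); apply/seteqP; split=> w /=.
    move=> [iso Xc]; split=> v; first by rewrite -Xc ffunE.
    rewrite finset.in_setC1 => vu; rewrite /B/= in_itv/= andbT -Xc !ffunE ltNge.
    by apply/negP => e; apply: (iso v); apply/edgeE; split; rewrite // eq_sym.
  move=> [wV wE]; have Xc : X w = c.
    by apply/ffunP => v; rewrite ffunE wV// finset.in_setT.
  split=> // v /edgeE[uv]; apply/negP; rewrite -ltNge.
  have := wE v; rewrite finset.in_setC1 eq_sym uv /B/= in_itv/= andbT => /(_ isT).
  by rewrite -Xc !ffunE.
rewrite exchange_big/=; apply: eq_bigr => a _.
(* Sum and product are exchanged; the factor of [u] is [mu_vec a]. *)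
rewrite -(bigA_distr_bigA (F a)) (bigD1 u)//=; congr (_ * _).
  rewrite (bigD1 a)//= [X in _ + X]big1 ?addr0 /F ?eqxx// => b ba.
  by rewrite (negbTE ba).
rewrite (eq_bigr (fun=> 1 - \prod_l Gamma mu0 mu1 q (a l))).
  by rewrite prodr_const cardC1 card_ord.
move=> v vu; rewrite -sum_mu_q_vec -mu_vec_sum1 -sumrB.
by apply: eq_bigr => b _; rewrite /F (negbTE vu); ring.
Qed.

(** Union bound over the nodes. Since [Gamma(0) <= Gamma(1)], every product of [Gamma(a_l)] is at
    least [Gamma(0)^L], and [1 - y <= exp(-y)] bounds each isolation probability uniformly in
    [a]. *)
Lemma no_isolated_lower : (0 < L)%N ->
  Gamma mu0 mu1 q false <= Gamma mu0 mu1 q true ->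
  1 - n%:R * expR (- (n.-1%:R * Gamma mu0 mu1 q false ^+ L)) <=
  fine (P (no_isolated q A U n L)).
Proof.
move=> L0 G01.
have Gp x : 0 <= Gamma mu0 mu1 q x <= 1.
  have [h1 h1'] := q01 x false; have [h2 h2'] := q01 x true.
  apply/andP; split; first by rewrite addr_ge0 ?mulr_ge0 ?ltW.
  by rewrite -[leRHS]mu_sum1 lerD// ger_pMl// ltW.
pose x := Gamma mu0 mu1 q false ^+ L.
have iso u : fine (P (isolated u)) <= expR (- (n.-1%:R * x)).
  rewrite prob_isolated//.
  have -> : expR (- (n.-1%:R * x)) = \sum_a mu_vec a * expR (- (n.-1%:R * x)).
    by rewrite -mulr_suml mu_vec_sum1 mul1r.
  apply: ler_sum => a _; rewrite ler_wpM2l ?mu_vec_ge0//.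
  rewrite -mulrN. rewrite expRM_natl.
  have pa : x <= \prod_l Gamma mu0 mu1 q (a l) <= 1.
    rewrite prodr_ile1// andbT /x -[X in _ ^+ X]card_ord -prodr_const.
    apply: ler_prod => l _; have /andP[-> _] := Gp false.
    by case: (a l); rewrite /= ?lexx.
  rewrite lerXn2r ?nnegrE ?expR_ge0//.
    by move: pa => /andP[_]; rewrite subr_ge0.
  by apply: le_trans (expR_ge1Dx _); case/andP: pa => ? _; lra.
have mU := @has_mean_sum _ _ _ P _ (index_enum 'I_n) xpredT _ _
  (fun u _ => has_mean_indic P (measurable_isolated u)).
have := le_has_mean (has_mean_cst P 1)
  (has_meanD (has_mean_indic P measurable_no_isolated) mU).
have h w : 1 <= \1_(no_isolated q A U n L) w + \sum_(u < n) \1_(isolated u) w :> R.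
  have [NI|NI] := pselect (no_isolated q A U n L w).
    by rewrite indicE mem_set// ler_wpDr// sumr_ge0.
  have [u Iu] : exists u, isolated u w.
    by move: NI => /existsNP[u /forallNP]; exists u.
  by rewrite ler_wpDl// (bigD1 u)//= indicE mem_set// ler_wpDr// sumr_ge0.
move=> /(_ h); rewrite -lerBlDr; apply: le_trans.
rewrite lerD2l lerN2; apply: le_trans (ler_sum _ (fun u _ => iso u)) _.
by rewrite sumr_const card_ord -[leLHS]mulr_natl.
Qed.

End Graph.
End Model.

(** * Both limits, by squeezing between the finite-[n] bounds *)

Theorem theorem1 (R : realType) (d : measure_display) (T : measurableType d)
  (P : probability T R) (mu0 mu1 : R) (q : bool -> bool -> R)
  (A : nat -> nat -> T -> bool) (U : nat -> nat -> T -> R)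
  (rho : R) (L : nat -> nat) :
  0 < mu0 -> 0 < mu1 -> mu0 + mu1 = 1 ->
  q false true = q true false ->
  (forall a b, 0 < q a b /\ q a b < 1) ->
  (* the A's are measurable, i.i.d. with P[A=1] = mu(1), P[A=0] = mu(0) *)
  (forall l u, measurable [set w | A l u w]) ->
  (forall l u, P [set w | A l u w] = mu1%:E) ->
  (forall l u, P [set w | ~~ A l u w] = mu0%:E) ->
  (* the U's (u < v) are measurable and uniform on (0,1) *)
  (forall u v, (u < v)%N -> measurable_fun setT (U u v)) ->
  (forall u v, (u < v)%N -> forall B : set R, measurable B ->
     P (U u v @^-1` B) = (@lebesgue_measure R) (B `&` `]0, 1[)) ->
  (* mutual independence of all of them *)
  mag_indep P A U ->
  0 < rho ->
  Gamma mu0 mu1 q false < Gamma mu0 mu1 q true ->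
  0 < 1 + rho * ln mu0 ->
  (* rho-admissible scaling: L_n positive and L_n ~ rho ln n *)
  (forall n, (0 < L n)%N) ->
  (fun n => (L n)%:R / (rho * ln (n%:R : R))) @ \oo --> (1 : R) ->
  (1 + rho * ln (Gamma mu0 mu1 q false) < 0 ->
     (fun n => fine (P (no_isolated q A U n (L n)))) @ \oo --> (0 : R)) /\
  (0 < 1 + rho * ln (Gamma mu0 mu1 q false) ->
     (fun n => fine (P (no_isolated q A U n (L n)))) @ \oo --> (1 : R)).
Proof.
move=> mu0_gt0 mu1_gt0 mu_sum1 _ q01 mA PA1 PA0 mU PU indep rho0 G01 rhomu L0 admL.
have G0 : 0 < Gamma mu0 mu1 q false.
  have [h1 _] := q01 false false; have [h2 _] := q01 false true.
  by rewrite addr_gt0 ?mulr_gt0.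
have mNI n : measurable (no_isolated q A U n (L n)).
  exact: measurable_no_isolated.
split=> rhoG.
  have upper0 : (fun n => 4 * (n%:R * mu0 ^+ L n)^-1 +
      2 * (n%:R * Gamma mu0 mu1 q false ^+ L n)) @ \oo --> (0 : R).
    rewrite -[X in _ --> X]addr0 -[X in _ --> X + _](mulr0 4).
    rewrite -[X in _ --> _ + X](mulr0 2); apply: cvgD; apply: cvgM.
    - exact: cvg_cst.
    - exact: cvg_nat_mul_expV0 rho0 admL _ mu0_gt0 rhomu.
    - exact: cvg_cst.
    - exact: cvg_nat_mul_exp0 rho0 admL _ G0 rhoG.
  apply: squeeze_cvgr (cvg_cst 0) upper0; near=> n.
  rewrite fine_ge0//=; apply: (no_isolated_upper (P := P) (mu1 := mu1)) => //.
  by near: n; exact: nbhs_infty_gt.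
have lower1 : (fun n => 1 - n%:R * expR (- (n.-1%:R *
    Gamma mu0 mu1 q false ^+ L n))) @ \oo --> (1 : R).
  rewrite -[X in _ --> X]subr0; apply: cvgB; first exact: cvg_cst.
  exact: cvg_nat_mul_expRN rho0 admL _ G0 rhoG.
apply: (squeeze_cvgr _ lower1 (cvg_cst (1 : R))); near=> n.
rewrite (no_isolated_lower (P := P) (mu0 := mu0) (mu1 := mu1)) ?(ltW G01)//=.
by rewrite -lee_fin fineK ?fin_num_measure// probability_le1.
Unshelve. all: by end_near. Qed.
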